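(* For every positive integer $t$, if $n$ is sufficiently large in terms of $t$, then $\mathrm{ex}(n,F_{t,t})\le 5t^{3/2}n^{3/2}$.
   Context: $\mathrm{ex}(n,F)$ is the maximum number of edges in an $n$-vertex graph with no subgraph isomorphic to $F$. The grid $F_{t,t}$ is the graph with vertex set $[t]\times[t]$ in which two vertices are adjacent if and only if they differ in exactly one coordinate and in that coordinate they differ by exactly one. *)

(* Defs.v *)
From mathcomp Require Import all_boot all_order all_algebra.
Set Implicit Arguments. Unset Strict Implicit. Unset Printing Implicit Defensive.
Import Order.TTheory GRing.Theory Num.Theory.

(* A graph on a finite vertex type is given by a (symmetric, irreflexive)
   adjacency relation.  [contains eF eG] : the graph with adjacency eF is
   isomorphic to a (not necessarily induced) subgraph of the graph with
   adjacency eG, i.e. there is an injective map of vertices sending edges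
   to edges. *)
Definition contains (V W : finType) (eF : rel V) (eG : rel W) : bool :=
  [exists f : {ffun V -> W},
     injectiveb f && [forall x, forall y, eF x y ==> eG (f x) (f y)]].

Definition simple_graph n (E : {set 'I_n * 'I_n}) : bool :=
  [forall x, forall y, ((x, y) \in E) == ((y, x) \in E)] &&
  [forall x, (x, x) \notin E].

Definition edge_rel n (E : {set 'I_n * 'I_n}) : rel 'I_n :=
  fun x y => (x, y) \in E.

Definition n_edges n (E : {set 'I_n * 'I_n}) : nat :=
  #|[set p in E | (p.1 < p.2)%N]|.

Definition ex (V : finType) (eF : rel V) (n : nat) : nat :=
  \max_(E : {set 'I_n * 'I_n} | simple_graph E && ~~ contains eF (edge_rel E))
     n_edges E.

Definition adj1 (a b : nat) : bool := (a.+1 == b) || (b.+1 == a).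

Definition grid_adj (t : nat) : rel ('I_t * 'I_t) :=
  fun u v => ((u.1 == v.1) && adj1 u.2 v.2) || ((u.2 == v.2) && adj1 u.1 v.1).
Arguments grid_adj t : clear implicits.

(* Main.v *)
Require Import Defs.
From mathcomp Require Import all_boot all_order all_algebra.
From mathcomp Require Import zify.
Import Order.TTheory GRing.Theory Num.Theory.
Set Implicit Arguments. Unset Strict Implicit. Unset Printing Implicit Defensive.
Local Open Scope nat_scope.

(* Draw the t x t grid along its antidiagonals: it is swept out by a walk
   v_0 ... v_(2t) of G whose vertices at odd and at even positions are replaced
   alternately, the others being kept.  So it suffices to find a nonempty
   family of walks in which, after fixing the positions of one parity, the other
   interior vertices can be rechosen within the family so as to avoid any small
   set T, namely the O(t^2) vertices used so far.  Otherwise all walks can be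
   deleted in groups having the same even (or odd) positions, every walk of a
   group meeting the set T attached to that group at some interior position j;
   such a walk is determined by j, its parts before and after j, and O(t^2)
   choices for v_j.  Writing W_i for the number of walks of length i, this gives
   W_(2t) <= O(t^2) sum_j W_(j-1) W_(2t-1-j).  As the numbers of walks of even
   length are log-convex, d^2 W_a W_b <= n W_(a+b+2) for a + b even, d being the
   average degree, whence d^2 <= O(t^3) n. *)

(** * Cauchy-Schwarz and log-convex sequences in [nat] *)

Lemma nat_Cauchy_Schwarz (I : finType) (a b : I -> nat) :
  (\sum_i a i * b i) ^ 2 <= (\sum_i a i ^ 2) * (\sum_i b i ^ 2).
Proof.
(* After doubling, the inequality holds term by term: $2xy \le x^2+y^2$ with $x = a_i b_j$, $y = a_j
   b_i$. *)
rewrite -(leq_pmul2l (isT : 0 < 2)) -mulnn !big_distrlr /= mul2n -addnn.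
rewrite [X in _ <= 2 * X](_ : _ = \sum_i \sum_j (a i * b j) ^ 2); last first.
  by apply: eq_bigr => i _; apply: eq_bigr => j _; rewrite expnMn.
rewrite mul2n -addnn [X in _ <= _ + X]exchange_big -!big_split /=.
apply: leq_sum => i _; rewrite -!big_split /=; apply: leq_sum => j _.
have := (nat_Cauchy (a i * b j) (a j * b i)).1; lia.
Qed.

Section LogConvex.
Variable c : nat -> nat.
Hypothesis c_gt0 : forall i, 0 < c i.
Hypothesis c_cvx : forall i, c i.+1 ^ 2 <= c i * c i.+2.

(** Log-convexity makes the ratios $c_{i+1}/c_i$ nondecreasing; cross-multiplied to stay in
    [nat]. *)
Lemma log_convex_step i j : i <= j -> c i.+1 * c j <= c i * c j.+1.
Proof.
move=> /subnK<-; elim: (j - i) => [|l IH]; first by rewrite mulnC.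
rewrite addSn; set p := l + i in IH *.
rewrite -(leq_pmul2r (c_gt0 p)) -mulnA [c p.+1 * _]mulnC mulnA.
apply: (leq_trans (leq_mul IH (leqnn _))).
by rewrite -!mulnA mulnn leq_mul2l [c p.+2 * _]mulnC c_cvx orbT.
Qed.

Lemma log_convex_mul i j : c i * c j <= c 0 * c (i + j).
Proof.
wlog le_ij : i j / i <= j.
  by move=> IH; case/orP: (leq_total i j) => /IH //; rewrite mulnC addnC.
elim: i j le_ij => [|i IH] j lt_ij //.
apply: (leq_trans (log_convex_step (ltnW lt_ij))).
by rewrite addSnnS; apply: IH; lia.
Qed.
End LogConvex.

(** * Counting walks *)

Section Walks.
Variables (V : finType) (e : rel V).
Hypothesis e_sym : symmetric e.

Fixpoint walks_from k x : seq (seq V) :=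
  if k is k'.+1 then [seq x :: s | y <- enum (e x), s <- walks_from k' y]
  else [:: [:: x]].

Definition walks k := [seq w | x <- enum V, w <- walks_from k x].

(** The number of walks with [k] edges from [x]; the usual degree for [k = 1]. *)
Fixpoint deg k x := if k is k'.+1 then \sum_(y | e x y) deg k' y else 1.

Definition nwalks k := \sum_x deg k x.

Lemma mem_walks_from k x w :
  (w \in walks_from k x) =
  [&& size w == k.+1, ohead w == Some x & sorted e w].
Proof.
elim: k x w => [|k IH] x w.
  rewrite inE; case: w => [|y [|z s]] //=.
  by apply/eqP; case.
apply/allpairsPdep/idP => [[y [s [xy]]]|].
  rewrite IH mem_enum in xy *; case: s => [|z s] //= /and3P[sz /eqP[->] p] ->.
  by rewrite /= eqSS sz eqxx /= p andbT.
case: w => [|x' [|y s]] //= /and3P[sz /eqP[->] /andP[xy p]].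
by exists y, (y :: s); split; rewrite ?mem_enum // IH; apply/and3P.
Qed.

Lemma mem_walks k w : (w \in walks k) = (size w == k.+1) && sorted e w.
Proof.
apply/allpairsPdep/idP => [[x [s [_]]]|/andP[sz p]].
  by rewrite mem_walks_from => /and3P[ss _ p] ->; rewrite ss.
case: w sz p => // x s sz p; exists x, (x :: s).
by rewrite mem_enum mem_walks_from sz p /= eqxx.
Qed.

Lemma walks_from_uniq k x : uniq (walks_from k x).
Proof.
elim: k x => // k IH x; apply: allpairs_uniq_dep => //; first exact: enum_uniq.
move=> _ _ /allpairsPdep[y [s [_ ys ->]]] /allpairsPdep[y' [s' [_ ys' ->]]] /=.
case=> ss; move: ys ys'; rewrite -{s'}ss !mem_walks_from.
by move=> /and3P[_ /eqP-> _] /and3P[_ /eqP[->] _].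
Qed.

Lemma walks_uniq k : uniq (walks k).
Proof.
apply: allpairs_uniq_dep; [exact: enum_uniq|by move=> ? _; exact: walks_from_uniq|].
move=> _ _ /allpairsPdep[y [s [_ ys ->]]] /allpairsPdep[y' [s' [_ ys' ->]]] /= ss.
move: ys ys'; rewrite -{s'}ss !mem_walks_from.
by move=> /and3P[_ /eqP-> _] /and3P[_ /eqP[->] _].
Qed.

Lemma size_walks k : size (walks k) = nwalks k.
Proof.
rewrite size_allpairs_dep sumnE big_map big_enum; apply: eq_bigr => x _.
elim: k x => //= k IH x.
by rewrite size_allpairs_dep sumnE big_map big_enum; apply: eq_bigr.
Qed.

(** Cut a walk at position [i] and reverse its first part; the induction moves one edge across the
    cut at a time. *)
Lemma nwalksD i j : nwalks (i + j) = \sum_x deg i x * deg j x.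
Proof.
elim: i j => [|i IH] j; first by apply: eq_bigr => x _; rewrite mul1n.
rewrite addSnnS IH /=.
under eq_bigr do rewrite big_distrr /=.
under [RHS]eq_bigr do rewrite big_distrl /=.
rewrite (exchange_big_dep xpredT) //=; apply: eq_bigr => x _.
by under eq_bigl do rewrite e_sym.
Qed.

Lemma nwalksD_sqr i j : nwalks (i + j) ^ 2 <= nwalks i.*2 * nwalks j.*2.
Proof. by rewrite -!addnn !nwalksD; apply: nat_Cauchy_Schwarz. Qed.

Lemma nwalks0 : nwalks 0 = #|V|.
Proof. by rewrite /nwalks sum1_card. Qed.

Lemma nwalks_gt0 k : 0 < nwalks 1 -> 0 < nwalks k.
Proof.
rewrite /nwalks !lt0n !sum_nat_eq0 !negb_forall => /existsP[x].
rewrite /= sum_nat_eq0 negb_forall => /existsP[y]; rewrite !negb_imply /= andbT => xy.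
apply/existsP; exists x => /=; rewrite -lt0n.
elim: k x y xy => //= k IH x y xy.
by rewrite (bigD1 y) //= ltn_addr // (IH y x) // e_sym.
Qed.

Lemma nwalks_even_mul i j : 0 < nwalks 1 ->
  nwalks i.*2 * nwalks j.*2 <= #|V| * nwalks (i + j).*2.
Proof.
move=> W1; rewrite -nwalks0.
apply: (@log_convex_mul (fun i => nwalks i.*2)) => [l|l]; first exact: nwalks_gt0.
rewrite (_ : l.+1.*2 = l + l.+2); last lia.
exact: nwalksD_sqr.
Qed.

(** If both lengths are odd, Cauchy-Schwarz bounds each squared count by the two neighbouring even
    lengths; the smaller of one pair is then matched with the larger of the other. *)
Lemma nwalks_mul i j l : 0 < nwalks 1 -> i + j = l.*2 ->
  nwalks i * nwalks j <= #|V| * nwalks l.*2.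
Proof.
move=> W1 ijl; have : ~~ (odd i (+) odd j) by rewrite -oddD ijl odd_double.
have := odd_double_half i; have := odd_double_half j.
case: (odd i) (odd j) => [] [] //; move: i./2 j./2 => i' j' Ej Ei _; last first.
  rewrite -Ei -Ej !add0n (_ : l = i' + j'); last lia.
  exact: nwalks_even_mul.
have Ei' : i = i' + i'.+1 by lia.
have Ej' : j = j' + j'.+1 by lia.
rewrite -leq_sqr expnMn {1}Ei' {1}Ej'.
apply: (leq_trans (leq_mul (nwalksD_sqr _ _) (nwalksD_sqr _ _))).
have h1 := nwalks_even_mul i' j'.+1 W1.
have h2 := nwalks_even_mul i'.+1 j' W1.
rewrite (_ : i' + j'.+1 = l) in h1; last lia.
rewrite (_ : i'.+1 + j' = l) in h2; last lia.
by rewrite -mulnn [nwalks j'.*2 * _]mulnC mulnACA leq_mul.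
Qed.

Lemma nwalks_density i j l : 0 < nwalks 1 -> i + j = l.*2 ->
  nwalks 1 ^ 2 * (nwalks i * nwalks j) <= #|V| ^ 3 * nwalks l.+1.*2.
Proof.
move=> W1 ijl.
have h1 := nwalks_mul W1 ijl.
have h2 : nwalks 1 ^ 2 <= #|V| * nwalks 2 by have := nwalksD_sqr 0 1; rewrite nwalks0.
have h3 := nwalks_even_mul 1 l W1.
apply: (leq_trans (leq_mul h2 h1)).
rewrite mulnACA !expnS expn0 muln1 -!mulnA !leq_mul2l.
by rewrite h3 !orbT.
Qed.
End Walks.

(** * Robust families of sequences *)

Section Robust.
Variables (V : finType) (x0 : V) (K m : nat).
Implicit Types (w : seq V) (F : seq (seq V)) (T : {set V}).

(* [p] is stored so that keys of different parities never coincide. *)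
Definition parity_key p w : bool * seq V :=
  (p, [seq nth x0 w i | i <- iota 0 K.+3 & odd i == p]).

(** Only interior positions are tested: removing such a vertex leaves two nonempty walks. *)
Definition avoids p T w :=
  all (fun i => nth x0 w i \notin T) [seq i <- iota 1 K.+1 | odd i != p].

Definition robust F :=
  all (fun w => [forall p : bool, forall T : {set V}, (#|T| <= m) ==>
    has (fun w' => (parity_key p w' == parity_key p w) && avoids p T w') F]) F.

Lemma parity_keyP p w w' i :
  parity_key p w = parity_key p w' -> i < K.+3 -> odd i = p ->
  nth x0 w i = nth x0 w' i.
Proof.
move=> /(congr1 snd)/eq_in_map eq_ww' ltiK ip; apply: eq_ww'.
by rewrite mem_filter ip eqxx mem_iota.
Qed.

Lemma avoidsP p T w i :
  avoids p T w -> 0 < i < K.+2 -> odd i != p -> nth x0 w i \notin T.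
Proof. by move=> /allP avT iK ip; apply: avT; rewrite mem_filter ip mem_iota. Qed.

Lemma robustP F w p T : robust F -> w \in F -> #|T| <= m ->
  exists w', [/\ w' \in F, parity_key p w' = parity_key p w & avoids p T w'].
Proof.
move=> /allP rF /rF /forallP/(_ p)/forallP/(_ T)/implyP leTm /leTm.
by case/hasP=> w' w'F /andP[/eqP ? ?]; exists w'.
Qed.

(* Repeatedly discard all the members of [F] sharing a key for which some small
   set [T] blocks every one of them, and record [T] as the value of [tau] there;
   a discarded key no longer occurs, so it is recorded only once. *)
Lemma robust_or_blocked F :
  (exists F', [/\ {subset F' <= F}, F' != [::] & robust F']) \/
  (exists tau : bool * seq V -> {set V}, (forall key, #|tau key| <= m) /\
     forall w, w \in F -> exists p, ~~ avoids p (tau (parity_key p w)) w).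
Proof.
have [n] := ubnP (size F); elim: n F => // n IH F; rewrite ltnS => szF.
have [F0 | Fn0] := eqVneq F [::].
  by right; exists (fun=> set0); split=> [key|]; rewrite ?cards0 // F0.
have [rF|] := boolP (robust F); first by left; exists F; split.
move=> /allPn[w wF]; rewrite negb_forall => /existsP[p].
rewrite negb_forall => /existsP[T]; rewrite negb_imply => /andP[leTm /hasPn blT].
pose a w' := parity_key p w' != parity_key p w; set F1 := filter a F.
have /IH[[F' [sF' F'n0 rF']]|[tau [le_tau bl_tau]]] : size F1 < n.
- apply: leq_trans szF; rewrite size_filter -(count_predC a F).
  rewrite -addn1 leq_add2l -has_count.
  by apply/hasP; exists w => //; rewrite /= /a eqxx.
- by left; exists F'; split=> // w' /sF'; rewrite mem_filter => /andP[].
right; exists (fun key => if key == parity_key p w then T else tau key).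
split=> [key|w' w'F]; first by case: ifP.
have [eq_key | ne_key] := eqVneq (parity_key p w') (parity_key p w).
  by exists p; rewrite eq_key eqxx; have := blT _ w'F; rewrite eq_key eqxx.
have [|p' bl'] := bl_tau w'; first by rewrite mem_filter /a ne_key.
exists p'; case: eqP => // eq_key; have /= pp' := congr1 fst eq_key.
by move: ne_key; rewrite -{1}pp' eq_key eqxx.
Qed.

End Robust.

(** * Robust families of walks in dense graphs *)

Section RobustWalks.
Variables (V : finType) (e : rel V) (x0 : V) (K m : nat).
Hypothesis e_sym : symmetric e.

Definition proper_walk (w : seq V) :=
  all (fun i => nth x0 w i \notin take i w) (iota 1 K.+1).

Lemma proper_walkP w i j : proper_walk w -> size w = K.+3 ->
  0 < i < K.+2 -> 0 < j < K.+2 -> nth x0 w i = nth x0 w j -> i = j.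
Proof.
move=> /allP prw szw; wlog lt_ij : i j / i < j => [IH|] iK jK eq_ij.
  have [lt_ij|lt_ji|//] := ltngtP i j; first exact: IH.
  by apply/esym/IH.
have := prw j; rewrite mem_iota -eq_ij => /(_ jK); rewrite -(nth_take x0 lt_ij).
by rewrite mem_nth // size_take szw; case: ifP => // /negbT; lia.
Qed.

(** Each walk has an interior position [j.+1] whose vertex lies in a blocking set ([m] choices) or,
    if the walk is not proper, among the [j.+1] preceding vertices. The rest is a walk of length [j]
    and one of length [K - j]. *)
Lemma blocked_walks_bound (tau : bool * seq V -> {set V}) :
  (forall key, #|tau key| <= m) ->
  (forall w, w \in walks e K.+2 -> proper_walk w ->
     exists p, ~~ avoids x0 K p (tau (parity_key x0 K p w)) w) ->
  nwalks e K.+2 <=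
    \sum_(j < K.+1) (m + j.+1) * (nwalks e j * nwalks e (K - j)).
Proof.
move=> le_tau bl_tau; rewrite -size_walks.
(* The filler [x0] sits at position [j.+1], whose parity the key ignores, so the blocking set is
   known before the missing vertex is. *)
pose cand j (pq : seq V * seq V) :=
  enum (tau (parity_key x0 K (~~ odd j.+1) (pq.1 ++ x0 :: pq.2))) ++ pq.1.
pose blocked j := [seq pq.1 ++ z :: pq.2 |
  pq <- [seq (p, q) | p <- walks e j, q <- walks e (K - j)], z <- cand j pq].
have sz_blocked j : size (blocked j) <= (m + j.+1) * (nwalks e j * nwalks e (K - j)).
  rewrite size_allpairs_dep -!size_walks sumnE big_map mulnC.
  rewrite -(size_allpairs pair) -sum1_size big_distrl /= big_seq [leqRHS]big_seq.
  apply: leq_sum => _ /allpairsP[[p q] [/= pj qj ->]].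
  rewrite mul1n size_cat -cardE leq_add //=.
  by move: pj; rewrite mem_walks => /andP[/eqP->].
rewrite (@leq_trans (size (flatten [seq blocked j | j <- iota 0 K.+1]))) //; last first.
  rewrite size_flatten /shape -map_comp sumnE big_map -(subn0 K.+1) -/(index_iota _ _).
  by rewrite big_mkord; apply: leq_sum => j _ /=.
apply: uniq_leq_size (walks_uniq e _) _ => w ww.
have := ww; rewrite mem_walks => /andP[/eqP szw pw].
have splitw j : j < K.+1 -> nth x0 w j.+1 \in cand j (take j.+1 w, drop j.+2 w) ->
    w \in flatten [seq blocked j | j <- iota 0 K.+1].
  move=> ltjK cj; apply/flatten_mapP; exists j; first by rewrite mem_iota.
  apply/allpairsPdep; exists (take j.+1 w, drop j.+2 w), (nth x0 w j.+1).
  split=> //; last first.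
    by rewrite /= -drop_nth ?cat_take_drop // szw; lia.
  apply/allpairsP; exists (take j.+1 w, drop j.+2 w); split=> //=.
    by rewrite mem_walks take_sorted // size_takel ?szw ?eqxx //; lia.
  by rewrite mem_walks drop_sorted // size_drop szw andbT; apply/eqP; lia.
have [prw|] := boolP (proper_walk w); last first.
  move=> /allPn[[|j]]; rewrite mem_iota // => jK; rewrite negbK => rep.
  by apply: (splitw j); [lia|rewrite mem_cat rep orbT].
have [p /allPn[[|j]]] := bl_tau w ww prw; rewrite mem_filter mem_iota andbC //.
move=> /andP[jK jp]; rewrite negbK => bl; apply: (splitw j); first lia.
rewrite mem_cat mem_enum; apply/orP; left.
rewrite (_ : ~~ odd j.+1 = p); last by case: (p) (odd j.+1) jp => [] [].
suff -> : parity_key x0 K p (take j.+1 w ++ x0 :: drop j.+2 w) = parity_key x0 K p w.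
  by [].
congr (_, _); apply/eq_in_map => i; rewrite mem_filter mem_iota => /andP[/eqP ip iK].
have szt : size (take j.+1 w) = j.+1 by rewrite size_takel // szw; lia.
rewrite nth_cat szt; have [lt_ij|gt_ij|eq_ij] := ltngtP i j.+1.
- by rewrite nth_take.
- rewrite -(subnSK gt_ij) /= nth_drop; congr nth; lia.
- by move: jp; rewrite -eq_ij ip eqxx.
Qed.

Lemma robust_walks : ~~ odd K ->
  #|V| ^ 3 * (K.+1 * (m + K.+1)) < nwalks e 1 ^ 2 ->
  exists F, [/\ F != [::], robust x0 K m F &
    forall w, w \in F -> [/\ size w = K.+3, sorted e w & proper_walk w]].
Proof.
move=> evenK dense.
have W1 : 0 < nwalks e 1 by move: dense; case: (nwalks e 1) => //; rewrite ltn0.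
have [[F [sF Fn0 rF]]|[tau [le_tau bl_tau]]] :=
  robust_or_blocked x0 K m [seq w <- walks e K.+2 | proper_walk w].
  exists F; split=> // w /sF; rewrite mem_filter mem_walks.
  by case/and3P=> ? /eqP.
have bound : nwalks e K.+2 <=
    \sum_(j < K.+1) (m + j.+1) * (nwalks e j * nwalks e (K - j)).
  apply: blocked_walks_bound le_tau _ => w ww prw.
  by apply: bl_tau; rewrite mem_filter prw.
have K2 : K = K./2.*2 by rewrite -[LHS]odd_double_half (negPf evenK).
move: dense; rewrite ltnNge => /negP[].
(* Scaling by the number of walks lets [nwalks_density] bound each of the [K.+1] summands. *)
rewrite -(leq_pmul2r (nwalks_gt0 e_sym K.+2 W1)).
apply: leq_trans (leq_mul (leqnn _) bound) _; rewrite big_distrr /=.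
have -> : #|V| ^ 3 * (K.+1 * (m + K.+1)) * nwalks e K.+2 =
    \sum_(j < K.+1) (m + K.+1) * (#|V| ^ 3 * nwalks e K.+2).
  by rewrite sum_nat_const card_ord; lia.
apply: leq_sum => j _; rewrite mulnCA leq_mul ?leq_add2l //.
have jK : j + (K - j) = K./2.*2 by rewrite -K2 subnKC // -ltnS.
by have := nwalks_density e_sym W1 jK; rewrite doubleS -K2.
Qed.

End RobustWalks.

(** * Embedding the grid *)

(** Start anywhere in [F] and rechoose one parity at a time. Before the last step only [S] sequences
    of [K.+3] entries have been used, so robustness with bound [m] still applies. *)
Lemma resampling (V : finType) (x0 : V) K m (F : seq (seq V)) S :
  F != [::] -> robust x0 K m F -> (forall w, w \in F -> size w = K.+3) ->
  S * K.+3 <= m ->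
  exists h : nat -> seq V, [/\ forall s, s <= S -> h s \in F,
    forall r, r < S ->
      parity_key x0 K (odd r) (h r.+1) = parity_key x0 K (odd r) (h r) &
    forall r r', r' <= r -> r < S ->
      avoids x0 K (odd r) [set y in h r'] (h r.+1)].
Proof.
move=> Fn0 rF szF; elim: S => [|S IH] le_Sm.
  by case: F Fn0 {rF szF} => // w F _; exists (fun=> w); split; rewrite // mem_head.
have [|h [hF h_key h_av]] := IH; first by lia.
pose used := flatten [seq h r | r <- iota 0 S.+1].
have szu : #|[set y in used]| <= m.
  apply: leq_trans le_Sm; rewrite cardsE (leq_trans (card_size _)) //.
  rewrite size_flatten /shape -map_comp sumnE big_map.
  rewrite big_seq (@leq_trans (\sum_(r <- iota 0 S.+1) K.+3)) //.
    rewrite [leqRHS]big_seq; apply: leq_sum => r; rewrite mem_iota => /= le_rS.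
    by rewrite szF ?hF.
  by rewrite big_const_seq count_predT size_iota iter_addn_0 mulnC.
have [w' [w'F w'_key w'_av]] := robustP (odd S) rF (hF S (leqnn S)) szu.
pose h' s := if s == S.+1 then w' else h s.
have h'E s : s <= S -> h' s = h s by move=> le_sS; rewrite /h' ltn_eqF.
have h'S : h' S.+1 = w' by rewrite /h' eqxx.
exists h'; split=> [s|r|r r' le_r'r].
- by rewrite leq_eqVlt => /orP[/eqP->|lt_sS]; rewrite ?h'S // h'E // hF.
- rewrite ltnS leq_eqVlt => /orP[/eqP->|lt_rS]; first by rewrite h'S h'E.
  by rewrite !h'E ?h_key // ltnW.
rewrite ltnS leq_eqVlt => /orP[/eqP r_S|lt_rS]; last first.
  by rewrite !h'E ?h_av // (leq_trans le_r'r) // ltnW.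
rewrite r_S in le_r'r *; rewrite h'S h'E //; apply/sub_all: w'_av => i.
rewrite !inE; apply: contraNN => ih; apply/flatten_mapP.
by exists r'; rewrite ?mem_iota.
Qed.

Lemma grid_contained (V : finType) (x0 : V) (e : rel V) u m (F : seq (seq V)) :
  symmetric e -> (3 * u).+1 * u.*2.+3 <= m ->
  F != [::] -> robust x0 u.*2 m F ->
  (forall w, w \in F ->
     [/\ size w = u.*2.+3, sorted e w & proper_walk x0 u.*2 w]) ->
  contains (grid_adj u.+1) e.
Proof.
move=> e_sym le_m Fn0 rF walkF.
(* The last time needed is that of the corner [(u, u)], namely [u + u + u.+1]. *)
have [|h [hF h_key h_av]] := resampling Fn0 rF _ le_m.
  by move=> w /walkF[].
(* Antidiagonal a + b is read off the walk of time a + b + t, at positions a - b + t. *)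
pose f := [ffun ab : 'I_u.+1 * 'I_u.+1 =>
  nth x0 (h (ab.1 + ab.2 + u.+1)) (ab.1 + u.+1 - ab.2)].
have diag (a b : 'I_u.+1) : [/\ a + b + u.+1 <= (3 * u).+1,
    0 < a + u.+1 - b < u.*2.+2 & odd (a + u.+1 - b) = odd (a + b + u.+1)].
  by have := ltn_ord a; have := ltn_ord b; split; lia.
(* Positions of the parity of [s] are kept at the next time, so both edges lie on the walk
   [h s.+1]. *)
have f_adj s i : s < (3 * u).+1 -> 0 < i < u.*2.+2 -> odd i = odd s ->
    e (nth x0 (h s) i) (nth x0 (h s.+1) i.+1) /\
    e (nth x0 (h s) i) (nth x0 (h s.+1) i.-1).
  move=> lt_sS iK par; rewrite -(parity_keyP (h_key s lt_sS) _ par); last lia.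
  have [szw /(sortedP x0) pw _] := walkF _ (hF _ lt_sS).
  split; first by apply: pw; rewrite szw; lia.
  by rewrite e_sym -{2}(prednK (n := i)); [apply: pw; rewrite szw|]; lia.
(* At time [s] the positions of its parity have just been rechosen off all earlier walks. *)
have f_fresh s i s' i' : s' < s -> s <= (3 * u).+1 -> 0 < i < u.*2.+2 ->
    0 < i' < u.*2.+2 -> odd i = odd s -> nth x0 (h s) i <> nth x0 (h s') i'.
  case: s => // r; rewrite ltnS => le_s'r lt_rS iK i'K par eq_f.
  have := avoidsP (h_av r s' le_s'r lt_rS) iK; rewrite par /= eq_f inE.
  have [szw _ _] := walkF _ (hF s' (leq_trans le_s'r (ltnW lt_rS))).
  rewrite mem_nth ?szw; [by case: (odd r) => /(_ isT)|lia].
apply/existsP; exists f; apply/andP; split.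
  apply/injectiveP => -[a b] [a' b']; rewrite !ffunE /=.
  have [sS iK par] := diag a b; have [sS' iK' par'] := diag a' b'.
  have [lt|gt|eq_s] := ltngtP (a + b + u.+1) (a' + b' + u.+1).
  - by move/esym/f_fresh=> /(_ lt sS' iK' iK par').
  - by move/f_fresh=> /(_ gt sS iK iK' par).
  (* On one antidiagonal, properness of the walk separates the points. *)
  rewrite -eq_s; have [szw _ pw] := walkF _ (hF _ sS).
  move/(proper_walkP pw szw iK iK') => eq_i.
  have := ltn_ord b; have := ltn_ord b' => ltb' ltb.
  by congr (_, _); apply: val_inj => /=; lia.
have step (p q : 'I_u.+1 * 'I_u.+1) :
    (p.1 == q.1) && (p.2.+1 == q.2 :> nat) || (p.2 == q.2) && (p.1.+1 == q.1 :> nat) ->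
    e (f p) (f q).
  case: p q => [a b] [a' b'] /= ab; rewrite !ffunE /=.
  have [sS iK par] := diag a b; have [sS' _ _] := diag a' b'.
  have [|eR eL] := f_adj _ _ _ iK par.
    by case/orP: ab => /andP[/eqP eq1 /eqP eq2]; move: sS'; rewrite -eq1 -eq2; lia.
  case/orP: ab => /andP[/eqP eq1 /eqP eq2].
    have -> : a' + b' + u.+1 = (a + b + u.+1).+1 by rewrite -eq1 -eq2; lia.
    by have -> : a' + u.+1 - b' = (a + u.+1 - b).-1 by rewrite -eq1 -eq2; lia.
  have -> : a' + b' + u.+1 = (a + b + u.+1).+1 by rewrite -eq1 -eq2; lia.
  by have -> : a' + u.+1 - b' = (a + u.+1 - b).+1
    by rewrite -eq1 -eq2; have := ltn_ord b; lia.
apply/forallP => p; apply/forallP => q; apply/implyP.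
rewrite /grid_adj /adj1 !andb_orr => /orP[]/orP[] /andP[/eqP eq1 eq2].
- by apply: step; rewrite eq1 eq2 eqxx.
- by rewrite e_sym; apply: step; rewrite eq1 eq2 eqxx.
- by apply: step; rewrite eq1 eq2 eqxx orbT.
- by rewrite e_sym; apply: step; rewrite eq1 eq2 eqxx orbT.
Qed.

(** * From walks to edges, and the final bound *)

Lemma double_n_edges n (E : {set 'I_n * 'I_n}) :
  simple_graph E -> (n_edges E).*2 <= nwalks (edge_rel E) 1.
Proof.
case/andP=> /forallP symE _.
have -> : nwalks (edge_rel E) 1 = #|E|.
  rewrite /nwalks /= pair_big_dep /= sum1_card; apply: eq_card => -[x y].
  by rewrite unfold_in.
pose up := [set p in E | p.1 < p.2]; pose swap (p : 'I_n * 'I_n) := (p.2, p.1).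
have swap_inj : injective swap by move=> [a b] [c d] [-> ->].
have sz_down : #|swap @: up| = n_edges E by rewrite card_imset.
rewrite -addnn -{2}sz_down -cardsUI.
rewrite (_ : _ :&: _ = set0) ?cards0 ?addn0; last first.
  apply/setP => p; rewrite !inE; apply/negbTE/negP => /andP[/andP[_ lt_p]].
  by case/imsetP=> q; rewrite inE => /andP[_ lt_q] Ep; by move: lt_p; rewrite Ep /= ltnNge ltnW.
apply/subset_leq_card/subUsetP; split; apply/subsetP => p.
  by rewrite inE => /andP[].
case/imsetP=> -[x y]; rewrite inE => /andP[xyE _] ->.
by have /forallP/(_ y)/eqP <- := symE x.
Qed.

Lemma grid_free_n_edges t n (E : {set 'I_n * 'I_n}) : 0 < t ->
  simple_graph E -> ~~ contains (grid_adj t) (edge_rel E) ->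
  n_edges E ^ 2 <= 25 * (t * n) ^ 3.
Proof.
case: t => // u _ sE; apply: contraNT; rewrite -ltnNge => dense.
have e_sym : symmetric (edge_rel E).
  by case/andP: sE => /forallP sE _ x y; have /forallP/(_ y)/eqP := sE x.
have [p _] : exists p, p \in [set p in E | p.1 < p.2].
  apply/set0Pn; apply: contraTneq dense => E0.
  by rewrite /n_edges E0 cards0.
pose m := (3 * u).+1 * u.*2.+3.
have [||F [Fn0 rF walkF]] := @robust_walks _ _ p.1 u.*2 m e_sym; first by rewrite odd_double.
  have le_W := double_n_edges sE; rewrite -leq_sqr in le_W.
  apply: leq_trans le_W; rewrite card_ord.
  (* Here 100 is 4 times 25, the 4 coming from squaring [double_n_edges]. *)
  have : u.*2.+1 * (m + u.*2.+1) <= 100 * u.+1 ^ 3 by rewrite /m; nia.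
  rewrite -(leq_pmul2l (m := n ^ 3)); last by rewrite expn_gt0 (leq_ltn_trans _ (ltn_ord p.1)).
  by move=> le; apply: leq_ltn_trans le _; move: dense; rewrite expnMn -mul2n expnMn; lia.
exact: grid_contained rF walkF.
Qed.

Lemma sqr_ex_grid t n : 0 < t -> ex (grid_adj t) n ^ 2 <= 25 * (t * n) ^ 3.
Proof.
move=> t0; apply: (big_ind (fun k => k ^ 2 <= 25 * (t * n) ^ 3)) => // [a b le_a le_b|E].
  by rewrite /maxn; case: ifP.
by case/andP; apply: grid_free_n_edges.
Qed.

Local Open Scope ring_scope.

(* t^{3/2} n^{3/2} = (t n) * sqrt (t n), evaluated in any real closed field. *)
Theorem theorem1p3 :
  forall t : nat, (0 < t)%N ->
  exists N : nat, forall n : nat, (N <= n)%N ->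
    forall R : rcfType,
      ((ex (grid_adj t) n)%:R : R)
        <= 5 * (t * n)%:R * Num.sqrt ((t * n)%:R : R).
Proof.
move=> t t0; exists 0%N => n _ R; set M := (t * n)%N.
rewrite -(ler_pXn2r (isT : (0 < 2)%N)) ?nnegrE ?ler0n ?mulr_ge0 ?sqrtr_ge0 ?ler0n //.
rewrite exprMn sqr_sqrtr ?ler0n // exprMn -!natrX -!natrM ler_nat.
by have := sqr_ex_grid n t0; rewrite -/M; lia.
Qed.
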